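(* Let $(X,T)$ be a weak Banach mean equicontinuous topological dynamical system. Then all points of $X$ are uniformly generic points.
   Context: A topological dynamical system $(X,T)$ is a compact metric space $X$ with metric $d$ together with a continuous map $T:X\to X$. For integers $0\le m<n$, $S_{n,m}$ is the group of permutations of $\{m,m+1,\dots,n-1\}$. For a real family $(a_{m,n})_{0\le m<n}$, $\limsup_{n-m\to+\infty}a_{m,n}=\lim_{N\to\infty}\sup\{a_{m,n}: n-m\ge N\}$, $\liminf_{n-m\to+\infty}$ is defined analogously with $\inf$, and $\lim_{n-m\to+\infty}a_{m,n}$ exists if these agree (and are finite). Define $$\overline{BF}(x,y)=\limsup_{n-m\to+\infty}\ \inf_{\sigma\in S_{n,m}}\frac1{n-m}\sum_{k=m}^{n-1}d(T^kx,T^{\sigma(k)}y).$$ $(X,T)$ is weak Banach mean equicontinuous (equivalently, $\overline{BF}$-continuous) if for every $x\in X$ and every $\varepsilon>0$ there is $\delta>0$ such that $d(x,y)<\delta$ implies $\overline{BF}(x,y)<\varepsilon$. A point $x\in X$ is uniformly generic if for every continuous $f:X\to\mathbb{R}$ the limit $\lim_{n-m\to+\infty}\frac1{n-m}\sum_{k=m}^{n-1}f(T^kx)$ exists. *)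

(* Defs.v *)
From mathcomp Require Import all_boot all_order all_algebra all_fingroup.
From mathcomp Require Import all_classical all_reals all_analysis.

Set Implicit Arguments.
Unset Strict Implicit.
Unset Printing Implicit Defensive.

Import Order.TTheory GRing.Theory Num.Theory.
Import numFieldNormedType.Exports.

Local Open Scope classical_set_scope.
Local Open Scope ring_scope.

Section BanachLimits.
Context {R : realType}.
Implicit Types a : nat -> nat -> R.

Definition tail_values a (N : nat) : set (\bar R) :=
  [set r | exists m n : nat, [/\ (m < n)%N, (N <= n - m)%N & r = (a m n)%:E]].

(* As N grows the sets [tail_values a N] decrease, so the sequences below are
   monotone and their limits exist in \bar R: [limn] is never junk here. *)
Definition banach_limsup a : \bar R :=
  limn (fun N => ereal_sup (tail_values a N)).

Definition banach_liminf a : \bar R :=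
  limn (fun N => ereal_inf (tail_values a N)).

Definition banach_lim_exists a : Prop :=
  banach_limsup a = banach_liminf a /\ banach_limsup a \is a fin_num.

End BanachLimits.

Section Dynamics.
Context {R : realType} {X : metricType R}.
Variable T : X -> X.

Definition topological_dynamical_system : Prop :=
  compact [set: X] /\ continuous T.

(* The permutations of {m, ..., n-1}, seen as the permutations of {0, ..., n-1}
   that fix every k < m. *)
Definition interval_perms (n m : nat) : {set {perm 'I_n}} :=
  Sym [set k : 'I_n | (m <= k)%N]%SET.

(* An infimum over a nonempty finite set of reals, hence a minimum. *)
Definition BF_average (x y : X) (m n : nat) : R :=
  inf [set (n - m)%:R^-1 *
           \sum_(k < n | (m <= k)%N) mdist (iter k T x) (iter (sigma k) T y)
      | sigma in [set` interval_perms n m]].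

Definition BF_upper (x y : X) : \bar R := banach_limsup (BF_average x y).

Definition weak_Banach_mean_equicontinuous : Prop :=
  forall (x : X) (eps : R), 0 < eps ->
    exists2 delta : R, 0 < delta &
      forall y : X, mdist x y < delta -> (BF_upper x y < eps%:E)%E.

Definition birkhoff_average (f : X -> R) (x : X) (m n : nat) : R :=
  (n - m)%:R^-1 * \sum_(m <= k < n) f (iter k T x).

Definition uniformly_generic (x : X) : Prop :=
  forall f : X -> R, continuous f -> banach_lim_exists (birkhoff_average f x).

End Dynamics.

(* Main.v *)
(* Matching orbits up to a permutation with small average distance makes their
   Birkhoff sums close, so Birkhoff averages of length [n] starting at time 0
   are continuous in the point up to an error vanishing as [n] grows.  If
   long windows of the orbit of [x] have average above [c], then for every [L]
   some time [k] is a leader: all windows of length at most [L] starting at [k]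
   have average above [c].  A cluster point [y] of these [T^k x] has all its
   Birkhoff averages at least [c], and since [y] is approached by the orbit of
   [x], the averages of [x] itself are eventually above [c], up to epsilon.
   Applied to [f] and to [- f], this squeezes the Banach upper and lower limits
   together. *)

Require Import Defs.
From mathcomp Require Import all_boot all_order all_algebra all_fingroup.
From mathcomp Require Import all_classical all_reals all_analysis.
From mathcomp Require Import lra.

Set Implicit Arguments.
Unset Strict Implicit.
Unset Printing Implicit Defensive.

Import Order.TTheory GRing.Theory Num.Theory.
Import numFieldNormedType.Exports.

Local Open Scope classical_set_scope.
Local Open Scope ring_scope.

(** * Banach upper and lower limits of families indexed by windows *)

Section BanachLimits.
Context {R : realType}.
Implicit Types (a : nat -> nat -> R) (c M : R).

Lemma banach_limsupE a :
  banach_limsup a = ereal_inf (range (fun N => ereal_sup (tail_values a N))).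
Proof.
apply/cvg_lim => //; apply: ereal_nonincreasing_cvgn => N1 N2 N12.
apply: ereal_sup_le => _ [m [n [mn Nmn ->]]].
by exists m, n; split=> //; exact: leq_trans Nmn.
Qed.

(** Trades lower limits for upper limits of the opposite family, so that only [banach_limsup] needs
    estimates. *)
Lemma banach_liminfN a :
  banach_liminf a = (- banach_limsup (fun m n => (- a m n)%R))%E.
Proof.
have liminfE : banach_liminf a =
    ereal_sup (range (fun N => ereal_inf (tail_values a N))).
  apply/cvg_lim => //; apply: ereal_nondecreasing_cvgn => N1 N2 N12.
  apply: ereal_inf_le_tmp => _ [m [n [mn Nmn ->]]].
  by exists m, n; split=> //; exact: leq_trans Nmn.
rewrite liminfE banach_limsupE -ereal_supN -image_comp.
congr (ereal_sup _); rewrite !image_comp; congr (_ @` _).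
apply/funext => N /=; rewrite ereal_infEN; congr (- ereal_sup _)%E.
apply/seteqP; split=> [_ [_ [m [n [mn Nmn ->]]] <-]|_ [m [n [mn Nmn ->]]]].
  by exists m, n; rewrite EFinN.
by exists (a m n)%:E => //; exists m, n.
Qed.

Lemma banach_limsup_lt a c : (banach_limsup a < c%:E)%E ->
  exists N, forall m n, (m < n)%N -> (N <= n - m)%N -> a m n < c.
Proof.
rewrite banach_limsupE => /ereal_inf_lt[_ [N _ <-] supN]; exists N => m n mn Nmn.
rewrite -lte_fin; apply: le_lt_trans supN; apply: ereal_sup_ubound.
by exists m, n.
Qed.

Lemma banach_limsup_gt a c : (c%:E < banach_limsup a)%E ->
  forall N, exists m n, [/\ (m < n)%N, (N <= n - m)%N & c < a m n].
Proof.
rewrite banach_limsupE => ca N.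
have /ereal_sup_gt[_ [m [n [mn Nmn ->]]]] :
    (c%:E < ereal_sup (tail_values a N))%E.
  by apply: lt_le_trans ca _; apply: ereal_inf_lbound; exists N.
by rewrite lte_fin => can; exists m, n.
Qed.

Lemma banach_limsup_fin_num a M :
  (forall m n, (m < n)%N -> `|a m n| <= M) -> banach_limsup a \is a fin_num.
Proof.
move=> aM; rewrite fin_numElt; apply/andP; split.
  rewrite ltNge; apply/negP; rewrite leeNy_eq => /eqP ay.
  have [|N /(_ 0 N.+1 isT)] := @banach_limsup_lt a (- M).
    by rewrite ay ltNyr.
  rewrite subn0 leqnSn => /(_ isT) /lt_geF.
  by have := aM 0 N.+1 isT; rewrite ler_norml => /andP[-> _].
rewrite ltNge; apply/negP; rewrite leye_eq => /eqP ay.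
have [|m [n [mn _]]] := @banach_limsup_gt a M _ 0%N; first by rewrite ay ltry.
by rewrite ltNge (le_trans (ler_norm _) (aM _ _ mn)).
Qed.

End BanachLimits.

(** * Window sums of a bounded real sequence *)

Section Sequences.
Context {R : realType}.
Variables (u : nat -> R) (M : R).
Hypothesis uM : forall k, `|u k| <= M.

Lemma norm_window_sum m n : `|\sum_(m <= j < n) u j| <= M * (n - m)%:R.
Proof.
apply: le_trans (ler_norm_sum _ _ _) _.
by apply: le_trans (ler_sum _ (fun j _ => uM j)) _; rewrite sumr_const_nat mulr_natr.
Qed.

(** Tiles are cut off from the left until at most [L] terms remain. The remainder costs at most
    [M * L], and [|c| * L] absorbs its share of [c * n] when [c] is negative. *)
Lemma tiled_window_sum_le (c : R) (L : nat) :
  (forall k, exists l,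
    [/\ (0 < l)%N, (l <= L)%N & \sum_(k <= j < k + l) u j <= c * l%:R]) ->
  forall n m, \sum_(m <= j < m + n) u j <= c * n%:R + (M + `|c|) * L%:R.
Proof.
move=> tile n; have [k] := ubnP n; elim: k n => // k IHk n; rewrite ltnS => nk m.
have M0 : 0 <= M := le_trans (normr_ge0 _) (uM 0).
have c0 := normr_ge0 c.
case: (leqP n L) => [nL|Ln].
  have := le_trans (ler_norm _) (norm_window_sum m (m + n)).
  rewrite addKn => /le_trans; apply.
  have nLR : n%:R <= L%:R :> R by rewrite ler_nat.
  have n0 : 0 <= n%:R :> R by [].
  have : (M + `|c|) * n%:R <= (M + `|c|) * L%:R by rewrite ler_wpM2l// addr_ge0.
  have : - c * n%:R <= `|c| * n%:R by rewrite ler_wpM2r// -normrN ler_norm.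
  by nra.
have [l [l0 lL sl]] := tile m.
have ln : (l < n)%N by exact: leq_ltn_trans Ln.
rewrite (@big_cat_nat _ _ _ (m + l)) ?leq_addr ?leq_add2l ?(ltnW ln)//=.
rewrite -[in X in _ + X <= _](subnKC (ltnW ln)) addnA.
have := IHk (n - l)%N _ (m + l)%N.
rewrite (leq_trans _ nk) ?ltn_subrL ?l0 ?(leq_ltn_trans _ ln)// => /(_ isT).
have -> : n%:R = l%:R + (n - l)%:R :> R by rewrite -natrD subnKC// ltnW.
by nra.
Qed.

(* If no such [k] existed, long windows could be tiled by windows of length at
   most [L] with average at most [c], forcing their average close to [c]. *)
Lemma exists_leader (c c' : R) (L : nat) : c < c' ->
  (forall N, exists m n, [/\ (m < n)%N, (N <= n - m)%N &
    c' * (n - m)%:R < \sum_(m <= j < n) u j]) ->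
  exists k, forall l, (0 < l)%N -> (l <= L)%N ->
    c * l%:R < \sum_(k <= j < k + l) u j.
Proof.
move=> cc' long; apply: contrapT => noleader.
have tile k : exists l,
    [/\ (0 < l)%N, (l <= L)%N & \sum_(k <= j < k + l) u j <= c * l%:R].
  apply: contrapT => nol; apply: noleader; exists k => l l0 lL.
  by rewrite ltNge; apply/negP => sl; apply: nol; exists l.
pose K := (M + `|c|) * L%:R.
(* Beyond this length the gain [(c' - c) * (n - m)] exceeds the tiling error [K]. *)
have [m [n [mn Nmn]]] := long (Num.truncn (K / (c' - c))).+1.
rewrite ltNge => /negP; apply.
have := tiled_window_sum_le tile (n - m) m.
rewrite subnKC ?(ltnW mn)// => /le_trans; apply; rewrite -/K.
have : K / (c' - c) < (n - m)%:R.
  by apply: lt_le_trans (truncnS_gt _) _; rewrite ler_nat.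
by rewrite ltr_pdivrMr ?subr_gt0//; nra.
Qed.

(* Shifting a window by [k] changes at most [2 k] terms. *)
Lemma eventually_window_sum_gt_shift (c c' : R) (k N : nat) : c < c' ->
  (forall n, (N <= n)%N -> c' * n%:R < \sum_(k <= j < k + n) u j) ->
  exists N', forall n, (N' <= n)%N -> c * n%:R < \sum_(0 <= j < n) u j.
Proof.
move=> cc' shift.
exists (maxn N (Num.truncn (2 * M * k%:R / (c' - c))).+1) => n.
rewrite geq_max => /andP[Nn Kn].
have : 2 * M * k%:R / (c' - c) < n%:R.
  by apply: lt_le_trans (truncnS_gt _) _; rewrite ler_nat.
rewrite ltr_pdivrMr ?subr_gt0// => K.
have := shift n Nn.
(* Both sides are the sum over [0, k + n). *)
have E : \sum_(0 <= j < k) u j + \sum_(k <= j < k + n) u j =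
    \sum_(0 <= j < n) u j + \sum_(n <= j < k + n) u j.
  by rewrite -!big_cat_nat ?leq_addr ?leq_addl.
have := norm_window_sum 0 k; have := norm_window_sum n (k + n).
rewrite addnK subn0 !ler_norml => /andP[_ +] /andP[+ _].
by move: E; nra.
Qed.

End Sequences.

(** * Birkhoff sums in a compact system *)

Section Dynamics.
Context {R : realType} {X : metricType R}.
Variables (T : X -> X).
Hypothesis Xcompact : compact [set: X].
Hypothesis Tcont : continuous T.
Implicit Types (f : X -> R) (x y : X) (c : R).

Lemma bounded_continuous f : continuous f -> exists M, forall z, `|f z| <= M.
Proof.
move=> fc.
have : \forall M \near +oo, forall z, [set: X] z -> `|f z| <= M.
  apply: ((compact_near_coveringP [set: X]).1 Xcompact) => z _.
  have fz : nbhs z (f @^-1` ball (f z) 1) by apply: fc; exact: nbhsx_ballx.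
  near=> y M.
  have : ball (f z) 1 (f y) by near: y.
  rewrite /ball/= => fzy.
  have : `|f z| + 1 <= M by near: M; exact: nbhs_pinfty_ge (num_real _).
  apply: le_trans; rewrite -(subrK (f z) (f y)) (le_trans (ler_normD _ _))//.
  by rewrite addrC lerD2l distrC ltW.
by move=> /filter_ex[M fM]; exists M => z; exact: fM.
Unshelve. all: by end_near.
Qed.

(** Uniform continuity handles close points, and a steep slope handles distant ones since [f] is
    bounded. Being affine in the distance, the bound can be averaged along matched orbits. *)
Lemma continuous_almost_lipschitz f (e : R) : continuous f -> 0 < e ->
  exists2 C, 0 < C & forall a b, `|f a - f b| <= e + C * mdist a b.
Proof.
move=> fc e0; have [M fM] := bounded_continuous fc.
have : \forall C \near +oo, forall a, [set: X] a ->
    forall b, `|f a - f b| <= e + C * mdist a b.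
  apply: ((compact_near_coveringP [set: X]).1 Xcompact) => z _.
  have /nbhs_ballP[d /= d0 zd] : nbhs z (f @^-1` ball (f z) (e / 2)).
    by apply: fc; apply: nbhsx_ballx; rewrite divr_gt0.
  near=> a C => b /=.
  have az : mdist z a < d / 2.
    suff : ball z (d / 2) a by rewrite ballEmdist.
    by near: a; apply: nbhsx_ballx; rewrite divr_gt0.
  have C0 : 0 < C by near: C; exact: nbhs_pinfty_gt (num_real _).
  (* At distance at least [d / 2] the linear term is then at least [2 * M]. *)
  have CM : 4 * M / d <= C by near: C; exact: nbhs_pinfty_ge (num_real _).
  have d2 : d / 2 < d by lra.
  have ab0 := mdist_ge0 a b.
  case: (ltP (mdist a b) (d / 2)) => [ab|ab].
    have fzb : `|f z - f b| < e / 2.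
      apply: zd; rewrite ballEmdist/= (le_lt_trans (metric_triangle _ a _))//.
      lra.
    have fza : `|f z - f a| < e / 2 by apply: zd; rewrite ballEmdist/=; lra.
    have -> : f a - f b = (f z - f b) - (f z - f a) by lra.
    apply: le_trans (ler_normB _ _) _.
    have := mulr_ge0 (ltW C0) ab0; lra.
  apply: le_trans (ler_normB _ _) _; have := fM a; have := fM b.
  rewrite ler_pdivrMr// in CM; nra.
move=> near_lip.
have [C [fC C0]] := filter_ex (filterI near_lip (nbhs_pinfty_gt (num_real 0))).
by exists C => // a b; exact: fC.
Unshelve. all: by end_near.
Qed.

Lemma birkhoff_average_gtE f x c m n : (m < n)%N ->
  (c < birkhoff_average T f x m n) =
  (c * (n - m)%:R < \sum_(m <= k < n) f (iter k T x)).
Proof.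
by move=> mn; rewrite /birkhoff_average mulrC ltr_pdivlMr// ltr0n subn_gt0.
Qed.

Lemma birkhoff_sum_iter f x k n :
  \sum_(0 <= j < n) f (iter j T (iter k T x)) =
  \sum_(k <= j < k + n) f (iter j T x).
Proof.
have := big_addn 0 (k + n) k xpredT (fun j => f (iter j T x)).
by rewrite add0n addKn => ->; apply: eq_bigr => j _; rewrite iterD.
Qed.

Lemma birkhoff_averageN f x m n :
  birkhoff_average T (fun z => - f z) x m n = - birkhoff_average T f x m n.
Proof. by rewrite /birkhoff_average sumrN mulrN. Qed.

Lemma continuous_birkhoff_sum f n : continuous f ->
  continuous (fun x => \sum_(0 <= k < n) f (iter k T x)).
Proof.
move=> fc; elim: n => [|n IHn] x.
  by under eq_fun do rewrite big_geq//; exact: cvg_cst.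
under eq_fun do rewrite big_nat_recr//=.
apply: cvgD; first exact: IHn.
have Tn : continuous (iter n T).
  elim: n {IHn} => [|n IHn] y; first exact: cvg_id.
  by apply: (@continuous_comp _ _ _ (iter n T) T); [exact: IHn|exact: Tcont].
by apply: (@continuous_comp _ _ _ (iter n T) f); [exact: Tn|exact: fc].
Qed.

(** A permutation of the times leaves the Birkhoff sum of [y] unchanged, so the terms can be
    compared along a nearly optimal matching. *)
Lemma BF_average_lt_birkhoff_sum f x y n (e C h : R) : 0 < C -> (0 < n)%N ->
  (forall a b, `|f a - f b| <= e + C * mdist a b) ->
  BF_average T x y 0 n < h ->
  `|\sum_(0 <= k < n) f (iter k T x) - \sum_(0 <= k < n) f (iter k T y)|
    <= (e + C * h) * n%:R.
Proof.
move=> C0 n0 fC /inf_lt[|_ [/= s _ <-]].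
  by apply: image_nonempty; exists (1%g : {perm 'I_n}) => /=; rewrite group1.
rewrite subn0 mulrC ltr_pdivrMr ?ltr0n// => sh.
rewrite !big_mkord [X in _ - X](reindex_inj (@perm_inj _ s))/= -sumrB.
apply: le_trans (ler_norm_sum _ _ _) _.
apply: le_trans (ler_sum _ (fun k _ => fC _ _)) _.
rewrite big_split/= sumr_const card_ord -mulr_sumr -(mulr_natr e).
by rewrite mulrDl lerD2l -mulrA ler_pM2l// ltW.
Qed.

Lemma weak_mean_equicontinuous_birkhoff_sum f y (e : R) :
  weak_Banach_mean_equicontinuous T -> continuous f -> 0 < e ->
  exists2 d, 0 < d & forall z, mdist y z < d ->
    exists N, forall n, (N <= n)%N ->
      `|\sum_(0 <= k < n) f (iter k T y) - \sum_(0 <= k < n) f (iter k T z)|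
        <= e * n%:R.
Proof.
move=> wBme fc e0.
have [C C0 fC] := continuous_almost_lipschitz fc (divr_gt0 e0 (ltr0n R 2)).
(* After multiplication by [C] the matching costs [e / 2]; the other half is the additive error in
   [fC]. *)
have [|d d0 yd] := wBme y (e / 2 / C); first by rewrite !divr_gt0.
exists d => // z /yd /banach_limsup_lt[N yzN]; exists N.+1 => n Nn.
have n0 : (0 < n)%N by exact: leq_trans Nn.
have := BF_average_lt_birkhoff_sum C0 n0 fC (yzN 0 n n0 _).
by rewrite subn0 (ltnW Nn) mulrCA divff ?gt_eqF// mulr1 -splitr; exact.
Qed.

Lemma exists_orbit_closure_leader f x c c' : continuous f -> c < c' ->
  (c'%:E < banach_limsup (birkhoff_average T f x))%E ->
  exists2 y, (forall d, 0 < d -> exists k, mdist y (iter k T x) < d) &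
    forall n, c * n%:R <= \sum_(0 <= j < n) f (iter j T y).
Proof.
move=> fc cc' c'x; have [M fM] := bounded_continuous fc.
have leader L : exists k, forall l, (0 < l)%N -> (l <= L)%N ->
    c * l%:R < \sum_(0 <= j < l) f (iter j T (iter k T x)).
  have [|N|k kL] := @exists_leader _ (fun j => f (iter j T x)) M _ c c' L cc'.
  - by [].
  - have [m [n [mn Nmn]]] := banach_limsup_gt c'x N.
    by rewrite birkhoff_average_gtE//; exists m, n.
  by exists k => l l0 lL; rewrite birkhoff_sum_iter; exact: kL.
have [k kP] := choice leader.
have [y [_ yk]] : exists y, [set: X] y /\
    cluster (iter (k L) T x @[L --> \oo]) y by apply: Xcompact; exact: filterT.
(* Every neighbourhood of [y] contains leaders for arbitrarily large [L]. *)
have yL (B : set X) N : nbhs y B -> exists2 L, (N < L)%N & B (iter (k L) T x).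
  move=> yB; have [|_ [[L /= NL <-] BL]] :=
    yk [set iter (k L) T x | L in [set L | (N < L)%N]] B _ yB; last by exists L.
  by exists N.+1 => // L NL; exists L.
exists y => [d d0|[|n]]; last 2 first.
- by rewrite mulr0 big_geq.
(* A sum of fixed length is continuous, so a deficit at [y] would persist at a nearby leader with
   [L > n]. *)
- rewrite leNgt; apply/negP => yn.
  have [|L nL] := yL
      [set z | \sum_(0 <= j < n.+1) f (iter j T z) < c * n.+1%:R] n.
    exact: (continuous_birkhoff_sum (n := n.+1) fc) (lt_nbhsl yn).
  by rewrite /= ltNge (ltW (kP L n.+1 isT nL)).
have [L _] := yL _ 0%N (nbhsx_ballx y d d0).
by rewrite ballEmdist; exists (k L).
Qed.

(** Windows of large average may start anywhere; moving to windows starting at 0 lets the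
    conclusions for [f] and [- f] meet on the same window. *)
Lemma eventually_birkhoff_average_gt f x c c' :
  weak_Banach_mean_equicontinuous T -> continuous f -> c < c' ->
  (c'%:E < banach_limsup (birkhoff_average T f x))%E ->
  exists N, forall n, (N <= n)%N -> c < birkhoff_average T f x 0 n.+1.
Proof.
move=> wBme fc cc' c'x; have [M fM] := bounded_continuous fc.
(* One [e] each for the leader, for passing from [y] to the orbit of [x], for strictness, and for
   shifting back to time 0. *)
pose e := (c' - c) / 4; have e0 : 0 < e by rewrite divr_gt0 ?subr_gt0.
have [|y yx yc] := @exists_orbit_closure_leader f x (c' - e) c' fc _ c'x.
  by rewrite ltrBlDr ltrDl.
have [d d0 yd] := weak_mean_equicontinuous_birkhoff_sum y wBme fc e0.
have [k /yd[N yN]] := yx d d0.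
have cc2 : c < c' - 3 * e by rewrite /e; lra.
have [|n Nn|N' xN'] := @eventually_window_sum_gt_shift _
    (fun j => f (iter j T x)) M _ c (c' - 3 * e) k N.+1 cc2.
- by [].
- have n0 : 0 < n%:R :> R by rewrite ltr0n (leq_trans _ Nn).
  have := yN n (ltnW Nn); have := yc n.
  by rewrite birkhoff_sum_iter ler_norml => + /andP[_]; nra.
by exists N' => n Nn; rewrite birkhoff_average_gtE// subn0 xN'// ltnW.
Qed.

End Dynamics.

Theorem proposition6p4 (R : realType) (X : metricType R) (T : X -> X) :
  topological_dynamical_system T ->
  weak_Banach_mean_equicontinuous T ->
  forall x : X, uniformly_generic T x.
Proof.
move=> [Xcompact Tcont] wBme x f fc.
have [M fM] := bounded_continuous Xcompact fc.
pose a := birkhoff_average T f x; pose a' m n := - a m n.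
have aM m n : (m < n)%N -> `|a m n| <= M.
  move=> mn; have nm0 : 0 < (n - m)%:R :> R by rewrite ltr0n subn_gt0.
  rewrite /a /birkhoff_average normrM normfV (gtr0_norm nm0) mulrC ler_pdivrMr//.
  exact: (@norm_window_sum _ (fun k => f (iter k T x))).
have a_fin := banach_limsup_fin_num aM.
have a'_fin : banach_limsup a' \is a fin_num.
  by apply: (@banach_limsup_fin_num _ _ M) => m n mn; rewrite normrN aM.
split=> //; rewrite banach_liminfN -/a -/a'.
case: (banach_limsup a) a_fin (@banach_limsup_lt _ a)
    (@eventually_birkhoff_average_gt _ _ T Xcompact Tcont f x) => // s _ s_lt s_gt.
have fNc : continuous (fun z => - f z) by move=> z; apply: cvgN; exact: fc.
have := @eventually_birkhoff_average_gt _ _ T Xcompact Tcont (fun z => - f z) x.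
have -> : birkhoff_average T (fun z => - f z) x = a'.
  by apply/funext => m; apply/funext => n; rewrite birkhoff_averageN.
case: (banach_limsup a') a'_fin (@banach_limsup_lt _ a') => // i _ i_lt i_gt.
congr EFin; apply/eqP; rewrite eq_le; apply/andP; split.
  (* Here [- i] is the lower limit. If [- i < s], a common initial window has average above
     [s - 2 * e] and opposite above [i - 2 * e], but these bounds add up to 0. *)
  rewrite leNgt; apply/negP => si; pose e := (s + i) / 4.
  have e0 : 0 < e by rewrite /e; lra.
  have [||N1 s1] := s_gt (s - 2 * e) (s - e) wBme fc; [lra|rewrite lte_fin; lra|].
  have [||N2 s2] := i_gt (i - 2 * e) (i - e) wBme fNc; [lra|rewrite lte_fin; lra|].
  have := s1 _ (leq_maxl N1 N2); have := s2 _ (leq_maxr N1 N2).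
  by rewrite /a' /a /e; lra.
(* The lower limit cannot exceed the upper one: on a long window the bounds [s + e] and [i + e] add
   up to 0. *)
rewrite leNgt; apply/negP => si; pose e := (- i - s) / 2.
have [|N1 s1] := s_lt (s + e); first by rewrite lte_fin /e; lra.
have [|N2 s2] := i_lt (i + e); first by rewrite lte_fin /e; lra.
have := s1 0 (maxn N1 N2).+1 isT; have := s2 0 (maxn N1 N2).+1 isT.
rewrite subn0 !leqW ?leq_maxl ?leq_maxr// => /(_ isT) + /(_ isT).
by rewrite /a' /e; lra.
Qed.
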